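(* Let $D\subseteq\mathbb{R}^2$ be a Jordan domain. Then the sweeping cost $\mathrm{SC}(D)$ is at least as large as the length of the shortest area-bisecting curve in $D$, that is, $\mathrm{SC}(D)\ge\inf\{L(\gamma)\ |\ \gamma \text{ is an area-bisecting curve in } D\}$.
   Context: A Jordan domain $D\subseteq\mathbb{R}^2$ is a homeomorphic image of a closed disk in $\mathbb{R}^2$, with boundary $\partial D$. $L(\gamma)$ denotes the length of a continuous path $\gamma$; $\gamma$ is rectifiable if $L(\gamma)<\infty$. $\mathrm{area}$ denotes planar Lebesgue measure. Let $I=[0,1]$. A sensor curve in $D$ is a continuous map $f\colon I\times I\to D$ such that (i) each curve $f(\cdot,t)\colon I\to D$ is rectifiable and injective for $t\in(0,1)$; (ii) $f(I,0)$ and $f(I,1)$ are each (possibly distinct) single points in $\partial D$; (iii) $f(s,t)\in\partial D$ implies $s\in\{0,1\}$ or $t\in\{0,1\}$. The length of a sensor curve is $L(f)=\max_{t\in I}L(f(\cdot,t))$. A sensor curve $f$ is a sweep of $D$ if for every continuous path $\gamma\colon I\to D$ there is some $t\in I$ with $\gamma(t)\in f(I,t)$. Let $\mathcal{F}(D)$ be the set of all sensor curves that are sweeps of $D$. The sweeping cost of $D$ is $\mathrm{SC}(D)=\inf_{f\in\mathcal{F}(D)}L(f)$. An area-bisecting curve in $D$ is a rectifiable continuous curve $\gamma\colon I\to D$ that separates $D$ into two parts of equal area, i.e. $D\setminus\gamma(I)$ is the union of two disjoint relatively open subsets of $D$, each of area $\frac12\mathrm{area}(D)$. *)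

(* Defs.v *)
From mathcomp Require Import all_boot all_order all_algebra.
From mathcomp Require Import all_classical all_reals all_analysis.

Set Implicit Arguments.
Unset Strict Implicit.
Unset Printing Implicit Defensive.

Import Order.TTheory GRing.Theory Num.Theory.
Import numFieldNormedType.Exports.

Local Open Scope classical_set_scope.
Local Open Scope ring_scope.

Section plane.
Context {R : realType}.

(* The norm carried by [R * R] is the sup norm, which induces the right topology
   but the wrong lengths, hence an explicit Euclidean distance. *)
Definition eucl_dist (p q : R * R) : R :=
  Num.sqrt ((p.1 - q.1) ^+ 2 + (p.2 - q.2) ^+ 2).

Definition closed_disk (c : R * R) (r : R) : set (R * R) :=
  [set p | eucl_dist c p <= r].

Definition boundary (A : set (R * R)) : set (R * R) := closure A `\` interior A.

Definition area (A : set (R * R)) : \bar R :=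
  ((@lebesgue_measure R) \x (@lebesgue_measure R))%E A.

Definition unit_itv : set R := `[0, 1].

(* Functions on subsets of [R] or [R * R] are represented by total functions,
   all of whose properties are relativized to the subset. *)
Definition homeomorphic_sets (A B : set (R * R)) : Prop :=
  exists h k : R * R -> R * R,
    [/\ h @` A = B,
        (forall x, A x -> k (h x) = x),
        {within A, continuous h} &
        {within B, continuous k}].

Definition jordan_domain (D : set (R * R)) : Prop :=
  exists (c : R * R) (r : R), 0 < r /\ homeomorphic_sets (closed_disk c r) D.

Definition path_in (D : set (R * R)) (g : R -> R * R) : Prop :=
  {within unit_itv, continuous g} /\ (forall s, unit_itv s -> D (g s)).

(* Length of the inscribed polygon at [0 = x_0 < x_1 < ... < x_n = 1], where
   [s = [:: x_1; ...; x_n]]: the planar analogue of [variation 0 1 g s]. *)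
Definition polygonal_length (g : R -> R * R) (s : seq R) : R :=
  let F := g \o nth 1 (0 :: s) in
  \sum_(0 <= n < size s) eucl_dist (F n) (F n.+1).

Definition curve_length (g : R -> R * R) : \bar R :=
  ereal_sup [set (polygonal_length g s)%:E | s in itv_partition 0 1].

Definition rectifiable (g : R -> R * R) : Prop := (curve_length g < +oo)%E.

Definition slice (f : R * R -> R * R) (t : R) : R -> R * R :=
  fun s => f (s, t).

Record sensor_curve (D : set (R * R)) (f : R * R -> R * R) : Prop := {
  sensor_continuous : {within unit_itv `*` unit_itv, continuous f} ;
  sensor_in : forall s t, unit_itv s -> unit_itv t -> D (f (s, t)) ;
  sensor_rectifiable : forall t, 0 < t < 1 -> rectifiable (slice f t) ;
  sensor_injective : forall t, 0 < t < 1 -> set_inj unit_itv (slice f t) ;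
  sensor_start : exists2 p, boundary D p & slice f 0 @` unit_itv = [set p] ;
  sensor_end : exists2 p, boundary D p & slice f 1 @` unit_itv = [set p] ;
  sensor_boundary : forall s t, unit_itv s -> unit_itv t ->
    boundary D (f (s, t)) -> (s = 0 \/ s = 1) \/ (t = 0 \/ t = 1)
}.

(* A supremum in the extended reals: it is the maximum whenever that exists. *)
Definition sensor_length (f : R * R -> R * R) : \bar R :=
  ereal_sup [set curve_length (slice f t) | t in unit_itv].

Definition sweep (D : set (R * R)) (f : R * R -> R * R) : Prop :=
  sensor_curve D f /\
  forall g, path_in D g ->
    exists2 t, unit_itv t & (slice f t @` unit_itv) (g t).

Definition sweeping_cost (D : set (R * R)) : \bar R :=
  ereal_inf [set sensor_length f | f in sweep D].

Definition relatively_open (D A : set (R * R)) : Prop :=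
  exists2 U : set (R * R), open U & A = D `&` U.

Definition area_bisecting (D : set (R * R)) (g : R -> R * R) : Prop :=
  [/\ path_in D g, rectifiable g &
   exists A B : set (R * R),
     [/\ relatively_open D A /\ relatively_open D B,
         A `&` B = set0,
         D `\` g @` unit_itv = A `|` B,
         area A = ((2^-1)%:E * area D)%E &
         area B = ((2^-1)%:E * area D)%E]].

End plane.

(* Main.v *)
(* At time t call a point of D contaminated if an evading path, i.e. one that
   avoids f(I,s) for all s <= t, can be there at time t. The contaminated set C_t
   and its complement in D \ f(I,t) are relatively open, and f(I,t) has area zero
   because it is rectifiable. An evader may stay put as long as the curve does not
   touch it, so the area of C_t never jumps downwards. It goes from area D at
   t = 0 to 0 at t = 1, as f is a sweep; hence at the last time at which it is at
   least half of area D it is exactly half, and f(.,t) bisects the area then. *)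
Require Import Defs.
From mathcomp Require Import all_boot all_order all_algebra.
From mathcomp Require Import all_classical all_reals all_analysis.
From mathcomp Require Import ring lra.
Set Implicit Arguments.
Unset Strict Implicit.
Unset Printing Implicit Defensive.
Import Order.TTheory GRing.Theory Num.Theory.
Import numFieldNormedType.Exports.
Local Open Scope classical_set_scope.
Local Open Scope ring_scope.

(** * Intermediate values for the measure of a family of sets *)

Section measure_ivt.
Context d (T : measurableType d) (R : realType).
Variable mu : {measure set T -> \bar R}.

(** A reverse Fatou lemma for sets: the unions of the tails have measure at least [c], and since the
    whole union has finite measure they converge in measure to [lim_sup_set F], which lies in [A] up
    to the null set [N]. *)
Lemma le_measure_frequently (F : nat -> set T) (A N : set T) (c : \bar R) :
  (forall n, measurable (F n)) -> measurable A -> measurable N ->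
  (mu (\bigcup_n F n) < +oo)%E -> mu N = 0%E ->
  (forall n, (c <= mu (F n))%E) ->
  (forall x, (forall n, exists2 m, (n <= m)%N & F m x) -> A x \/ N x) ->
  (c <= mu A)%E.
Proof.
move=> mF mA mN Foo N0 cF FA.
have Foo' : (mu (\bigcup_(k in [set k | (0 <= k)%N]) F k) < +oo)%E.
  by rewrite (_ : [set k | _] = setT)//; apply/seteqP; split.
have := @lim_sup_set_cvg _ _ _ mu F mF Foo'.
have mU n : measurable (\bigcup_(k in [set k | (n <= k)%N]) F k).
  exact: bigcup_measurable.
have mL : measurable (lim_sup_set F) by exact: bigcapT_measurable.
move=> cv; rewrite -(measureU0 mA mN N0); apply: (@le_trans _ _ (mu (lim_sup_set F))).
  rewrite -(cvg_lim _ cv)//; apply: lime_ge; first exact: cvgP cv.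
  apply: nearW => n; apply: le_trans (cF n) _.
  by apply: le_measure; rewrite ?inE// => x Fx; exists n => /=.
apply: le_measure; rewrite ?inE//; first exact: measurableU.
by move=> x Fx; apply: FA => n; have [m /= nm Fm] := Fx n I; exists m.
Qed.

(** The Fatou counterpart: the intersections of the tails increase, each has measure at most [c],
    and their union contains [A]. *)
Lemma ge_measure_eventually (F : nat -> set T) (A : set T) (c : \bar R) :
  (forall n, measurable (F n)) -> measurable A ->
  (forall n, (mu (F n) <= c)%E) ->
  (forall x, A x -> exists n, forall m, (n <= m)%N -> F m x) ->
  (mu A <= c)%E.
Proof.
move=> mF mA cF AF.
pose G n := \bigcap_(k in [set k | (n <= k)%N]) F k.
have mG n : measurable (G n) by exact: bigcap_measurableType.
have mU : measurable (\bigcup_n G n) by exact: bigcup_measurable.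
have ndG : nondecreasing_seq G.
  by move=> m n mn; apply/subsetPset => x Gx k /= nk; apply: Gx => /=; exact: leq_trans nk.
have cv := nondecreasing_cvg_mu (mu := mu) mG mU ndG.
apply: (@le_trans _ _ (mu (\bigcup_n G n))).
  apply: le_measure; rewrite ?inE// => x /AF[n nF]; exists n => // k /= nk; exact: nF.
rewrite -(cvg_lim _ cv)//; apply: lime_le; first exact: cvgP cv.
apply: nearW => n; apply: le_trans (cF n) => /=.
by apply: le_measure; rewrite ?inE// => x; apply => /=.
Qed.

(* The hypotheses allow [t |-> mu (C t)] to jump upwards but not downwards, so
   it takes the value [c] at the last time at which it is at least [c]. *)
Lemma measure_ivt (C N : R -> set T) (D : set T) (c : \bar R) :
  measurable D -> (mu D < +oo)%E ->
  (forall t, 0 <= t <= 1 -> measurable (C t)) ->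
  (forall t, 0 <= t <= 1 -> C t `<=` D) ->
  (forall t, 0 <= t <= 1 -> measurable (N t) /\ mu (N t) = 0%E) ->
  (forall t x, 0 <= t <= 1 -> D x -> ~ N t x -> exists2 e, 0 < e &
    forall s, 0 <= s -> t - e < s <= t -> C s x -> C t x) ->
  (forall t x, 0 <= t <= 1 -> C t x -> exists2 e, 0 < e &
    forall s, s <= 1 -> t <= s < t + e -> C s x) ->
  (c <= mu (C 0%R))%E -> (mu (C 1%R) <= c)%E ->
  exists2 t, 0 <= t <= 1 & mu (C t) = c.
Proof.
move=> mD Doo mC CD mN left right c0 c1.
pose S := [set t : R | 0 <= t <= 1 /\ (c <= mu (C t))%E].
have S0 : S 0 by split => //; rewrite lexx ler01.
have supS : has_sup S by split; [exists 0|exists 1 => x [/andP[]]].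
pose t := sup S.
have t01 : 0 <= t <= 1.
  rewrite (sup_upper_bound supS S0)/=.
  by apply: ge_sup => [|x [/andP[]]//]; exists 0.
exists t => //; apply/eqP; rewrite eq_le; apply/andP; split.
- have [t1|t1] := eqVneq t 1; first by rewrite t1.
  have {}t1 : t < 1 by rewrite lt_neqAle t1; case/andP: t01.
  (* Times tending to [t] from the right; the factor [1 - t] keeps them in the unit interval. They
     lie beyond the supremum, so [C] has measure below [c] there. *)
  pose s n := t + (1 - t) / n.+1%:R.
  have ts n : t < s n by rewrite ltrDl divr_gt0// subr_gt0.
  have s1 n : s n <= 1.
    rewrite /s -lerBrDl ler_pdivrMr// ler_peMr ?ler1n// subr_ge0 ltW//.
  have s01 n : 0 <= s n <= 1.
    by rewrite s1 andbT; case/andP: t01 => t0 _; exact: le_trans (ltW (ts n)).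
  apply: (@ge_measure_eventually (C \o s)) => [n|||x Cx] /=.
  + exact: mC.
  + exact: mC.
  + move=> n; rewrite leNgt; apply/negP => cs.
    have /(sup_upper_bound supS) : S (s n) by split => //; exact: ltW.
    by rewrite leNgt ts.
  + have [e e0 He] := right _ _ t01 Cx.
    have [n ne] : exists n, t + n.+1%:R^-1 < t + e.
      by apply: ltr_add_invr; rewrite ltrDl.
    exists n => m nm; apply: He => //; rewrite (ltW (ts m))/=.
    apply: le_lt_trans ne; rewrite lerD2l.
    rewrite ler_pdivrMr// (@le_trans _ _ 1)//; first by case/andP: t01; lra.
    rewrite mulrC ler_pdivlMr// mul1r ler_nat ltnS//.
(* Times in [S] tending to [t] from below. A point in infinitely many [C (s n)] persists in [C t]
   unless it lies in the null set [N t]. *)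
- have /choice[s Hs] : forall n : nat, exists s : R, S s /\ t - n.+1%:R^-1 < s.
    by move=> n; have [|s Ss ts] := @sup_adherent _ S n.+1%:R^-1 _ supS => //; exists s.
  have s01 n : 0 <= s n <= 1 by case: (Hs n) => -[].
  apply: (@le_measure_frequently (C \o s) _ (N t)) => /=.
  + by move=> n; exact: mC.
  + exact: mC.
  + by have [] := mN _ t01.
  + apply: le_lt_trans Doo; apply: le_measure; rewrite ?inE//.
      by apply: bigcup_measurable => n _; exact: mC.
    by move=> x [n _] /CD; exact.
  + by have [] := mN _ t01.
  + by move=> n; case: (Hs n) => -[].
  + move=> x Fx; have [Nx|Nx] := pselect (N t x); [by right|left].
    have Dx : D x by have [m _ /CD] := Fx 0; exact.
    have [e e0 He] := left _ _ t01 Dx Nx.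
    have [n ne] := ltr_add_invr e0.
    have [m nm Cm] := Fx n.
    apply: (He (s m)) => //; first by case/andP: (s01 m).
    case: (Hs m) => Sm tm; rewrite (sup_upper_bound supS Sm) andbT.
    apply: le_lt_trans tm; rewrite lerD2l lerN2 (le_trans _ (ltW ne))// add0r.
    by rewrite lef_pV2 ?posrE// ler_nat ltnS.
Qed.

End measure_ivt.


(** * Measurability and area of open and compact plane sets *)

Section plane_measurability.
Context {R : realType}.
Local Notation plane := (measurableTypeR R * measurableTypeR R)%type.

(** An open set is the union of the countably many open rectangles with rational corners that it
    contains. *)
Lemma open_plane_measurable (U : set (R * R)) :
  open U -> measurable (U : set plane).
Proof.
move=> oU.
pose B (q : (rat * rat) * (rat * rat)) : set (R * R) :=
  `]ratr q.1.1, ratr q.1.2[%classic `*` `]ratr q.2.1, ratr q.2.2[%classic.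
have mB q : measurable (B q : set plane).
  by apply: measurableX; exact: measurable_itv.
rewrite (_ : U = \bigcup_q (if `[< B q `<=` U >] then B q else set0)).
  by apply: countable_bigcupT_measurable => // q; case: ifP.
apply/seteqP; split => [p Up|p [q _]]; last first.
  by case: ifPn => [/asboolP|//]; exact.
have /nbhs_ballP[e /= e0 eU] : nbhs p U by exact: open_nbhs_nbhs.
have rat_around (x : R) : exists q : rat * rat,
    x - e < ratr q.1 /\ ratr q.1 < x < ratr q.2 /\ ratr q.2 < x + e.
  have [|a] := @rat_in_itvoo _ (x - e) x; first by lra.
  have [|b] := @rat_in_itvoo _ x (x + e); first by lra.
  rewrite !in_itv/= => /andP[? ?] /andP[? ?]; exists (a, b) => /=; split => //.
  by split => //; apply/andP.
have [q1 [q1a [q1b q1c]]] := rat_around p.1.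
have [q2 [q2a [q2b q2c]]] := rat_around p.2.
exists (q1, q2) => //; rewrite ifT.
  by rewrite /B /=; split; rewrite /= in_itv.
apply/asboolP => z [/=]; rewrite !in_itv/= => /andP[? ?] /andP[? ?].
apply: eU; split; rewrite /ball/= ltr_norml; lra.
Qed.

Lemma compact_plane_measurable (K : set (R * R)) :
  compact K -> measurable (K : set plane).
Proof.
move=> /compact_closed cK; rewrite -(setCK K); apply: measurableC.
apply: open_plane_measurable; apply: closed_openC; apply: cK.
exact: norm_hausdorff.
Qed.

Lemma area_rectangle (a b c d : R) : a <= b -> c <= d ->
  area (`[a, b] `*` `[c, d]) = ((b - a) * (d - c))%:E.
Proof.
have len (x y : R) : x <= y -> lebesgue_measure `[x, y] = (y - x)%:E.
  rewrite lebesgue_measure_itv/= lte_fin => xy; case: ltP => // yx.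
  by rewrite (_ : y - x = 0)//; lra.
move=> ab cd; rewrite /area product_measure1E; try exact: measurable_itv.
by rewrite EFinM -!len.
Qed.

Lemma compact_area_fin (K : set (R * R)) : compact K -> (area K < +oo)%E.
Proof.
move=> cK; have /compact_bounded[M [_ bM]] := cK.
pose m := `|M| + 1.
have K_sub : K `<=` `[- m, m] `*` `[- m, m].
  move=> p Kp; have /bM/(_ p Kp) : M < m by rewrite /m; have := ler_norm M; lra.
  rewrite /Num.norm/= ge_max => /andP[]; rewrite !ler_norml => ? ?.
  by split; rewrite /= in_itv.
have m0 : - m <= m by rewrite /m; have := normr_ge0 M; lra.
apply: (@le_lt_trans _ _ (area (`[- m, m] `*` `[- m, m]))); last first.
  by rewrite area_rectangle// ltry.
rewrite /area; apply: le_measure; rewrite ?inE//; first exact: compact_plane_measurable.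
by apply: measurableX; exact: measurable_itv.
Qed.

End plane_measurability.

(** * Rectifiable curves have area zero *)

Section rectifiable_null.
Context {R : realType}.
Implicit Type g : R -> R * R.
Local Notation TV := total_variation.

(** For every partition, an increment of the first coordinate is at most the Euclidean distance. *)
Lemma curve_length_variation g :
  (total_variation 0 1 (fst \o g) <= curve_length g)%E.
Proof.
apply: ge_ereal_sup => _ [_ [s sP <-] <-].
apply: (@le_trans _ _ (polygonal_length g s)%:E); last first.
  by apply: ereal_sup_ubound; exists s.
rewrite lee_fin; apply: ler_sum => n _ /=.
rewrite distrC -sqrtr_sqr ler_wsqrtr// lerDl sqr_ge0//.
Qed.

(** Heine-Cantor: continuity gives a radius near each point, and the near-covering form of
    compactness makes it uniform. *)
Lemma compact_unif_continuous (K : set R) (f : R -> R) (e : R) :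
  compact K -> {within K, continuous f} -> 0 < e ->
  exists2 d, 0 < d & forall x y, K x -> K y -> `|x - y| < d -> `|f x - f y| < e.
Proof.
move=> /compact_near_coveringP/near_covering_withinP cK /subspace_continuousP cf e0.
have := cK R (nbhs 0) (fun d x => forall y, K y -> `|x - y| < d -> `|f x - f y| < e) _.
case=> [x Kx|d /= d0 dP]; last first.
  exists (d / 2); first by rewrite divr_gt0.
  move=> x y Kx Ky xy; apply: (dP (d / 2)) => //=.
  by rewrite sub0r normrN gtr0_norm; lra.
have e2 : 0 < e / 2 by rewrite divr_gt0.
have /nbhs_ballP[r /= r0 rP] : nbhs x (fun z => K z -> `|f x - f z| < e / 2).
  exact: (cvg_ball (cf x Kx) e2).
have r2 : 0 < r / 2 by rewrite divr_gt0.
exists (ball x (r / 2), ball (0 : R) (r / 2)) => /=.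
  by split; exact: nbhsx_ballx.
move=> [z d] /= [xz d0] Kz y Ky zy.
have fz : `|f x - f z| < e / 2 by apply: rP => //; apply: le_ball xz; lra.
have fy : `|f x - f y| < e / 2.
  apply: rP => //; rewrite /ball/= in xz d0 *.
  rewrite sub0r normrN in d0.
  apply: le_lt_trans (ler_distD z x y) _; rewrite (splitr r); apply: ltrD => //.
  exact: lt_trans zy (le_lt_trans (ler_norm _) d0).
apply: le_lt_trans (ler_distD (f x) (f z) (f y)) _.
by rewrite (splitr e); apply: ltrD => //; rewrite distrC.
Qed.

(* Cut the curve into short pieces: each one lies in a box whose width is twice
   the variation of the first coordinate along the piece and whose height is
   [2 * e], so the total area is at most [4 * e] times the total variation. *)
Lemma bounded_variation_area0 g : {within unit_itv, continuous g} ->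
  (total_variation 0 1 (fst \o g) < +oo)%E -> area (g @` unit_itv) = 0%E.
Proof.
move=> cg gV.
have cpt x y : 0 <= x -> y <= 1 -> compact (g @` `[x, y]).
  move=> x0 y1; apply: continuous_compact; last exact: segment_compact.
  apply: continuous_subspaceW cg => z; rewrite /unit_itv/= !in_itv/= => /andP[? ?].
  by apply/andP; split; lra.
have mg x y : 0 <= x -> y <= 1 ->
    measurable (g @` `[x, y] : set (measurableTypeR R * measurableTypeR R)).
  by move=> x0 y1; apply: compact_plane_measurable; exact: cpt.
have TVfin x y : 0 <= x -> x <= y -> y <= 1 -> TV x y (fst \o g) \is a fin_num.
  move=> x0 xy y1; rewrite ge0_fin_numE ?total_variation_ge0//.
  apply: le_lt_trans gV; rewrite (@total_variationD _ 0 1 x)//; last lra.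
  rewrite (@total_variationD _ x 1 y)// addeCA.
  by rewrite leeDl// adde_ge0// total_variation_ge0.
have cg2 : {within unit_itv, continuous (snd \o g)}.
  apply/subspace_continuousP => x Ix.
  have /subspace_continuousP/(_ x Ix) cgx := cg.
  exact: cvg_comp cgx cvg_snd.
have small e : 0 < e ->
    (area (g @` unit_itv) <= (4 * e)%:E * TV 0 1 (fst \o g))%E.
  move=> e0.
  have [d d0 dP] := compact_unif_continuous (@segment_compact R 0 1) cg2 e0.
  have piece x y : 0 <= x -> x <= y -> y <= 1 -> y - x < d ->
      (area (g @` `[x, y]) <= (4 * e)%:E * TV x y (fst \o g))%E.
    move=> x0 xy y1 xyd.
    pose v := fine (TV x y (fst \o g)).
    have v0 : 0 <= v by rewrite fine_ge0// total_variation_ge0.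
    pose B : set (R * R) := `[(g x).1 - v, (g x).1 + v] `*`
                            `[(g x).2 - e, (g x).2 + e].
    have gB : g @` `[x, y] `<=` B.
      move=> _ [z /= zxy <-]; move: zxy; rewrite in_itv/= => /andP[xz zy].
      split; rewrite /= in_itv/=; rewrite -ler_distl.
        rewrite -lee_fin fineK ?TVfin//.
        apply: le_trans (total_variation_ge (fst \o g) xz) _.
        by rewrite (total_variationD _ xz zy) leeDl// total_variation_ge0.
      apply/ltW/dP; rewrite /= ?in_itv/=; try (apply/andP; split; lra).
      by rewrite ger0_norm ?subr_ge0//; lra.
    apply: (@le_trans _ _ (area B)).
      apply: le_measure; rewrite ?inE//; first by apply: mg; lra.
      by apply: measurableX; exact: measurable_itv.
    rewrite /B area_rectangle; [|lra|lra].
    rewrite -(fineK (TVfin _ _ x0 xy y1)) -EFinM lee_fin -/v; nra.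
  (* The subdivision has [N.+1] equal pieces, with [N] so large that each is shorter than [d]. *)
  have [N Nd] := ltr_add_invr d0; rewrite add0r in Nd.
  have N0 : 0 < N.+1%:R :> R by rewrite ltr0n.
  pose x (n : nat) : R := n%:R / N.+1%:R.
  have x0 n : 0 <= x n by rewrite divr_ge0// ler0n.
  have xS n : x n.+1 = x n + N.+1%:R^-1 by rewrite /x -natr1 mulrDl mul1r.
  have xle n : x n <= x n.+1 by rewrite xS lerDl invr_ge0 ltW.
  have x1 n : (n <= N.+1)%N -> x n <= 1.
    by move=> nN; rewrite ler_pdivrMr// mul1r ler_nat.
  have step n : (n <= N.+1)%N ->
      (area (g @` `[0%R, x n]) <= (4 * e)%:E * TV 0 (x n) (fst \o g))%E.
    elim: n => [|n IH nN].
      by move=> _; apply: piece; rewrite ?x0 ?x1// /x mul0r; lra.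
    have -> : g @` `[0, x n.+1] = g @` `[0, x n] `|` g @` `[x n, x n.+1].
      rewrite -image_setU; congr (_ @` _); apply/seteqP; split => z /=.
        rewrite !in_itv/= => /andP[z0 zx]; have [zn|zn] := leP z (x n).
          by left; rewrite z0.
        by right; rewrite (ltW zn).
      have := xle n; have := x0 n.
      by rewrite !in_itv/= => ? ? [|] /andP[? ?]; apply/andP; split; lra.
    rewrite (@total_variationD _ 0 (x n.+1) (x n))// ge0_muleDr ?total_variation_ge0//.
    apply: le_trans (leeD (IH (ltnW nN)) (piece _ _ (x0 n) (xle n) (x1 _ nN) _)).
      by apply: measureU2; apply: mg => //; apply: x1 => //; exact: ltnW.
    by rewrite xS [x n + _]addrC addrK.
  have := step N.+1 (leqnn _); rewrite /x divff//; exact: lt0r_neq0.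
apply/eqP; rewrite eq_le measure_ge0 andbT.
apply/lee_addgt0Pr => e e0; rewrite add0e.
pose V := fine (TV 0 1 (fst \o g)).
have V0 : 0 <= V by rewrite fine_ge0// total_variation_ge0.
(* With this choice the bound becomes [e * (V / (V + 1))], at most [e]; the [+ 1] covers the case
   [V = 0]. *)
have /small : 0 < e / (4 * (V + 1)) by rewrite divr_gt0// mulr_gt0// ltr_wpDl.
move/le_trans; apply.
rewrite -(fineK (TVfin 0 1 (lexx _) ler01 (lexx _))) -EFinM lee_fin -/V.
have V1 : 0 < V + 1 by rewrite ltr_wpDl.
rewrite (_ : 4 * (e / (4 * (V + 1))) * V = e * (V / (V + 1))).
  by rewrite ler_piMr ?(ltW e0)// ler_pdivrMr// mul1r lerDl.
by field; exact: lt0r_neq0.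
Qed.

End rectifiable_null.

(** * Evading paths in a convex parameter set *)

Section evasion.
Context {R : realType}.

Definition mix (a : R) (p q : R * R) : R * R :=
  ((1 - a) * p.1 + a * q.1, (1 - a) * p.2 + a * q.2).

Lemma mix0 p q : mix 0 p q = p.
Proof. by case: p => x y; rewrite /mix subr0 !mul1r !mul0r !addr0. Qed.

Lemma mix1 p q : mix 1 p q = q.
Proof. by case: q => x y; rewrite /mix subrr !mul1r !mul0r !add0r. Qed.

(** This is convexity of [E]. *)
Definition mix_closed (E : set (R * R)) :=
  forall a p q, 0 <= a <= 1 -> E p -> E q -> E (mix a p q).

Lemma mix_closed_ball (p : R * R) (e : R) : mix_closed (ball p e).
Proof.
have seg (x y z a : R) : 0 <= a <= 1 -> `|z - x| < e -> `|z - y| < e ->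
    `|z - ((1 - a) * x + a * y)| < e.
  move=> /andP[a0 a1]; rewrite !ltr_norml => /andP[? ?] /andP[? ?].
  (* The mixed coordinate exceeds the smaller one by a nonnegative product and falls short of the
     larger one by another; these are the products [m1] and [m2] (in some order). *)
  have [xy|/ltW yx] := leP x y.
    have xy0 : 0 <= y - x by rewrite subr_ge0.
    have m1 := mulr_ge0 a0 xy0; have a1' : 0 <= 1 - a by rewrite subr_ge0.
    by have m2 := mulr_ge0 a1' xy0; apply/andP; split; lra.
  have yx0 : 0 <= x - y by rewrite subr_ge0.
  have m1 := mulr_ge0 a0 yx0; have a1' : 0 <= 1 - a by rewrite subr_ge0.
  by have m2 := mulr_ge0 a1' yx0; apply/andP; split; lra.
by move=> a q q' a01 [q1 q2] [q1' q2']; split; exact: seg.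
Qed.

(** The power [r ^+ 2] minus squared distance at the mixed point is the convex combination of its
    values at [p] and [q] plus [a * (1 - a)] times the squared distance of [p] and [q]; all three
    terms are nonnegative. *)
Lemma mix_closed_disk (c : R * R) (r : R) : 0 <= r -> mix_closed (closed_disk c r).
Proof.
move=> r0 a p q /andP[a0 a1]; rewrite /closed_disk /eucl_dist /=.
have sqrtP (x y : R) : Num.sqrt (x ^+ 2 + y ^+ 2) <= r <-> x ^+ 2 + y ^+ 2 <= r ^+ 2.
  by rewrite -{1}(ger0_norm r0) -sqrtr_sqr ler_sqrt ?sqr_ge0.
rewrite !sqrtP /mix /= => pr qr; rewrite -subr_ge0 in pr; rewrite -subr_ge0 in qr.
have a1' : 0 <= 1 - a by rewrite subr_ge0.
have pq0 : 0 <= (p.1 - q.1) ^+ 2 + (p.2 - q.2) ^+ 2 by rewrite addr_ge0 ?sqr_ge0.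
have := addr_ge0 (addr_ge0 (mulr_ge0 a1' pr) (mulr_ge0 a0 qr))
  (mulr_ge0 (mulr_ge0 a0 a1') pq0).
rewrite -[X in _ -> is_true X]subr_ge0 => /le_trans; apply.
by rewrite le_eqVlt; apply/orP; left; apply/eqP; ring.
Qed.

Lemma mix_continuous (phi : R -> R) (g : R -> R * R) (q : R * R) :
  continuous phi -> continuous g -> continuous (fun s => mix (phi s) (g s) q).
Proof.
move=> cphi cg s.
have g1 : (g x).1 @[x --> s] --> (g s).1 by exact: cvg_comp (cg s) cvg_fst.
have g2 : (g x).2 @[x --> s] --> (g s).2 by exact: cvg_comp (cg s) cvg_snd.
have seg (u : R -> R) (l y : R) : u x @[x --> s] --> l ->
    ((1 - phi x) * u x + phi x * y) @[x --> s] --> (1 - phi s) * l + phi s * y.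
  move=> ul; apply: cvgD; apply: cvgM; try exact: cphi; try exact: cvg_cst; last by [].
  by apply: cvgB; [exact: cvg_cst|exact: cphi].
exact: cvg_pair (seg _ _ q.1 g1) (seg _ _ q.2 g2).
Qed.

Variables (E : set (R * R)) (free : R -> set (R * R)).
Hypothesis E_mix : mix_closed E.
Hypothesis free_open : forall t p, 0 <= t <= 1 -> E p -> free t p ->
  exists2 e, 0 < e & forall s q, 0 <= s <= 1 -> E q ->
    `|t - s| < e -> ball p e q -> free s q.

(* Points reached at time [t] by a path that has been free up to then. Paths
   live in the convex set [E] (later the disk that parametrizes the domain), where
   they can be modified by convex combinations. *)
Definition reach (t : R) (p : R * R) : Prop :=
  exists g : R -> R * R, [/\ continuous g, (forall s, E (g s)), g t = p &
    forall s, 0 <= s <= t -> free s (g s)].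

Lemma reach_in t p : reach t p -> E p.
Proof. by move=> [g [_ Eg <- _]]. Qed.

Lemma reach_free t p : 0 <= t -> reach t p -> free t p.
Proof. by move=> t0 [g [_ _ <- gf]]; apply: gf; rewrite lexx andbT. Qed.

Lemma reach0 p : E p -> free 0 p -> reach 0 p.
Proof.
move=> Ep fp; exists (fun=> p); split => //; first by move=> x; exact: cvg_cst.
by move=> s s0; rewrite (@le_anti _ _ s 0)// andbC.
Qed.

(** The evader halts at time [t]: replacing [s] by [Num.min s t] freezes the path continuously. *)
Lemma reach_stay t u p : t <= u -> reach t p ->
  (forall s, t <= s <= u -> free s p) -> reach u p.
Proof.
move=> tu [g [cg Eg gt gf]] fp; exists (fun s => g (Num.min s t)); split => //.
- move=> s; apply: (@continuous_comp _ _ _ (fun s => Num.min s t) g); last exact: cg.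
  exact: (@min_fun_continuous _ _ _ id (fun=> t) (fun=> cvg_id) (fun=> cvg_cst _)).
- by rewrite min_r.
- move=> s /andP[s0 su]; have [st|ts] := leP s t; first by apply: gf; rewrite s0.
  by rewrite gt; apply: fp; rewrite su ltW.
Qed.

(* A path ending at [q] is bent towards [q'] during the last [b] units of time,
   when it stays in a ball that is entirely free. *)
Lemma reach_local t p : 0 <= t <= 1 -> E p -> free t p ->
  exists2 e, 0 < e & forall q q', E q -> E q' -> ball p e q -> ball p e q' ->
    reach t q -> reach t q'.
Proof.
move=> t01 Ep fp; have [e e0 fe] := free_open t01 Ep fp.
exists e => // q q' Eq Eq' pq pq' [g [cg Eg gt gf]].
(* At time 0 there is no earlier time in which to bend the path, but a constant path at [q'] will
   do. *)
have [t0|t0] := eqVneq t 0.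
  rewrite t0; apply: reach0 => //; apply: (fe 0 q') => //; first by rewrite lexx ler01.
  by rewrite t0 subrr normr0.
have {}t0 : 0 < t by rewrite lt_neqAle eq_sym t0; case/andP: t01.
have /nbhs_ballP[d /= d0 gd] : nbhs t (g @^-1` ball p e).
  by apply: (cg t); rewrite gt; apply: open_nbhs_nbhs; split => //; exact: ball_open.
(* [b < d] keeps [g] inside the ball during the bending, and [b < e] keeps those times within reach
   of the free neighbourhood. *)
have [b b0 [be bd bt]] : exists2 b, 0 < b & [/\ b < e, b < d & b <= t].
  exists (Num.min (Num.min e d) t / 2).
    by rewrite divr_gt0// !lt_min e0 d0 t0.
  have m_e : Num.min (Num.min e d) t <= e by rewrite !ge_min lexx.
  have m_d : Num.min (Num.min e d) t <= d by rewrite !ge_min lexx orbT.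
  have m_t : Num.min (Num.min e d) t <= t by rewrite !ge_min lexx orbT.
  split; lra.
(* A clamped ramp, 0 up to time [t - b] and then rising linearly to 1 at time [t]. *)
pose phi s := Num.max 0 (Num.min 1 ((s - (t - b)) / b)).
have phi01 s : 0 <= phi s <= 1 by rewrite /phi le_max lexx ge_max ler01 ge_min lexx.
have cphi : continuous phi.
  apply: max_fun_continuous; first by move=> s; exact: cvg_cst.
  apply: min_fun_continuous; first by move=> s; exact: cvg_cst.
  move=> s; apply: cvgM; last exact: cvg_cst.
  by apply: cvgB; [exact: cvg_id|exact: cvg_cst].
have phi_t : phi t = 1 by rewrite /phi subKr divff ?gt_eqF// minxx max_r.
have phi_0 s : s <= t - b -> phi s = 0.
  move=> sb; rewrite /phi max_l// ge_min; apply/orP; right.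
  by rewrite pmulr_lle0 ?invr_gt0// subr_le0.
exists (fun s => mix (phi s) (g s) q'); split.
- exact: mix_continuous.
- by move=> s; exact: E_mix.
- by rewrite phi_t mix1.
- move=> s /andP[s0 st]; have [sb|sb] := leP s (t - b).
    by rewrite phi_0// mix0; apply: gf; rewrite s0.
  have ts : `|t - s| < b by rewrite ger0_norm ?subr_ge0// ltrBlDl -ltrBlDr.
  apply: fe => //; first by case/andP: t01 => _ t1; rewrite s0 (le_trans st).
  - exact: E_mix.
  - exact: lt_trans ts be.
  - by apply: mix_closed_ball => //; apply: gd; exact: lt_trans ts bd.
Qed.

End evasion.

(** * Transfer between the disk and the Jordan domain *)

Section jordan.
Context {R : realType}.
Local Notation plane := (measurableTypeR R * measurableTypeR R)%type.

Lemma within_continuous_ball (T U : pseudoMetricType R) (A : set T) (f : T -> U)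
    (x : T) (e : R) : {within A, continuous f} -> A x -> 0 < e ->
  exists2 d, 0 < d & forall y, A y -> ball x d y -> ball (f x) e (f y).
Proof.
move=> /subspace_continuousP cf Ax e0.
have /nbhs_ballP[d /= d0 fd] : nbhs x (fun y => A y -> ball (f x) e (f y)).
  exact: cf x Ax _ (nbhsx_ballx (f x) e e0).
by exists d => // y Ay xy; exact: fd.
Qed.

Lemma compact_closed_disk (c : R * R) (r : R) : 0 <= r -> compact (closed_disk c r).
Proof.
move=> r0.
pose Q : set (R * R) := `[c.1 - r, c.1 + r] `*` `[c.2 - r, c.2 + r].
apply: (@subclosed_compact _ _ Q).
- apply: (@closed_comp _ _ (eucl_dist c) [set x | x <= r]); last exact: closed_le.
  move=> p _; rewrite /eucl_dist.
  apply: (@cvg_comp _ _ _ (fun p : R * R => (c.1 - p.1) ^+ 2 + (c.2 - p.2) ^+ 2)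
    Num.sqrt _ _ _ _ (@sqrt_continuous _ _)).
  by apply: cvgD; apply: cvgM; apply: cvgB;
    [exact: cvg_cst|exact: cvg_fst|exact: cvg_cst|exact: cvg_fst
    |exact: cvg_cst|exact: cvg_snd|exact: cvg_cst|exact: cvg_snd].
- by apply: compact_setX; exact: segment_compact.
- have coord (x y : R) : Num.sqrt (x ^+ 2 + y ^+ 2) <= r -> `|x| <= r.
    by apply: le_trans; rewrite -sqrtr_sqr ler_wsqrtr// lerDl sqr_ge0.
  move=> p; rewrite /closed_disk /eucl_dist /= => pr; split; rewrite /= in_itv/=.
    by rewrite -ler_distl distrC; exact: coord pr.
  by rewrite -ler_distl distrC; rewrite addrC in pr; exact: coord pr.
Qed.

Lemma relatively_open_measurable (D A : set (R * R)) :
  measurable (D : set plane) -> relatively_open D A -> measurable (A : set plane).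
Proof.
by move=> mD [U oU ->]; apply: measurableI => //; exact: open_plane_measurable.
Qed.

Variables (E D : set (R * R)) (h k : R * R -> R * R).
Hypothesis hE : h @` E = D.
Hypothesis hK : forall x, E x -> k (h x) = x.
Hypothesis h_cont : {within E, continuous h}.
Hypothesis k_cont : {within D, continuous k}.

(** The image under [h] is the preimage of [P] under [k], and [k] is continuous on [D]. *)
Lemma homeo_relatively_open (P : set (R * R)) : P `<=` E ->
  (forall p, P p -> exists2 e, 0 < e & forall q, E q -> ball p e q -> P q) ->
  relatively_open D (h @` P).
Proof.
move=> PE openP; exists (interior [set x | D x -> P (k x)]); first exact: open_interior.
apply/seteqP; split => [_ [p Pp <-]|x [Dx /interior_subset/(_ Dx) Px]]; last first.
  move: Dx Px; rewrite -hE => -[p Ep <-]; rewrite hK// => Pp; by exists p.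
have Dhp : D (h p) by rewrite -hE; exists p => //; exact: PE.
split => //; have [e e0 eP] := openP _ Pp.
have [d d0 kd] := within_continuous_ball k_cont Dhp e0.
apply/nbhs_ballP; exists d => //= x hx Dx; have := kd x Dx hx.
rewrite hK; last exact: PE.
by apply: eP; move: Dx; rewrite -hE => -[q Eq <-]; rewrite hK.
Qed.

Lemma homeo_comp_path (g : R -> R * R) : continuous g -> (forall s, E (g s)) ->
  path_in D (h \o g).
Proof.
move=> cg Eg; split; last by move=> s _ /=; rewrite -hE; exists (g s).
apply: continuous_subspaceT => s.
apply/cvg_ballP => e e0; have [d d0 hd] := within_continuous_ball h_cont (Eg s) e0.
have /cvg_ballP/(_ d d0) := cg s; apply: filterS => x; exact: hd.
Qed.

(** Expressed in the parameter set, with [p] standing for the point [h p] of the domain. *)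
Definition evades (f : R * R -> R * R) (t : R) : set (R * R) :=
  [set p | ~ (slice f t @` unit_itv) (h p)].

(** Continuity separates [h p] from each single point of the slice, and compactness of the interval
    of curve parameters gives one radius for the whole slice. *)
Lemma evades_open (f : R * R -> R * R) t p :
  {within unit_itv `*` unit_itv, continuous f} ->
  0 <= t <= 1 -> E p -> evades f t p ->
  exists2 e, 0 < e & forall s q, 0 <= s <= 1 -> E q ->
    `|t - s| < e -> ball p e q -> evades f s q.
Proof.
move=> cf t01 Ep fp.
have /compact_near_coveringP/near_covering_withinP cI := @segment_compact R 0 1.
pose P (sq : R * (R * R)) u := unit_itv sq.1 -> E sq.2 -> f (u, sq.1) <> h sq.2.
have /nbhs_ballP[e /= e0 He] : nbhs (t, p) (fun sq => unit_itv `<=` P sq).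
  apply: (cI _ (nbhs (t, p)) P (nbhs_filter _)) => u Iu.
  have tI : unit_itv t by rewrite /unit_itv/= in_itv.
  have fhp : f (u, t) != h p by apply/eqP => fhp; apply: fp; exists u.
  have d0 : 0 < `|f (u, t) - h p| / 2 by rewrite divr_gt0// normr_gt0 subr_eq0.
  (* With half the distance as radius, the balls about [f (u, t)] and [h p] are disjoint. *)
  set d := `|f (u, t) - h p| / 2 in d0.
  have [a a0 fa] := within_continuous_ball cf (conj Iu tI : (_ `*` _) (u, t)) d0.
  have [b b0 hb] := within_continuous_ball h_cont Ep d0.
  exists (ball u a, ball (t, p) (Num.min a b)) => /=.
    by split; apply: nbhsx_ballx => //; rewrite lt_min a0.
  move=> [v [s q]] /= [uv [ts pq]] Iv Is Eq fhq.
  have /= fv : ball (f (u, t)) d (f (v, s)).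
    by apply: fa => //; split => //=; apply: le_ball ts; rewrite ge_min lexx.
  have /= hq : ball (h p) d (h q).
    by apply: hb => //; apply: le_ball pq; rewrite ge_min lexx orbT.
  have := ball_triangle fv; rewrite fhq => /(_ _ _ (ball_sym hq)).
  by rewrite -splitr -ball_normE /= ltxx.
exists e => // s q s01 Eq ts pq [u Iu fhq].
by apply: (He (s, q) _ u Iu) => //=; rewrite /unit_itv/= in_itv.
Qed.

End jordan.

(** * The bisecting slice of a sweep *)

Section bisection.
Context {R : realType}.
Local Notation plane := (measurableTypeR R * measurableTypeR R)%type.
Implicit Types (D : set (R * R)) (f : R * R -> R * R).

Lemma unit_itvP (t : R) : unit_itv t <-> 0 <= t <= 1.
Proof. by rewrite /unit_itv/= in_itv. Qed.

Lemma slice_continuous f t : {within unit_itv `*` unit_itv, continuous f} ->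
  unit_itv t -> {within unit_itv, continuous (slice f t)}.
Proof.
move=> cf It; apply/subspace_continuousP => s Is U /nbhs_ballP[e /= e0 eU].
have [d d0 fd] := within_continuous_ball cf (conj Is It : (_ `*` _) (s, t)) e0.
apply/nbhs_ballP; exists d => //= x sx Ix; apply/eU/(fd (x, t)) => //.
by split => //; exact: ballxx.
Qed.

Lemma sweep_bisecting D f : jordan_domain D -> sweep D f ->
  (forall t, unit_itv t -> rectifiable (slice f t)) ->
  exists2 t, unit_itv t & area_bisecting D (slice f t).
Proof.
move=> [c [r [r0 [h [k [hE hK h_cont k_cont]]]]]] [[cf fD _ _ _ _ _] fsweep] frect.
set E := closed_disk c r in hE hK h_cont.
have cD : compact D.
  by rewrite -hE; apply: continuous_compact h_cont _; exact/compact_closed_disk/ltW.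
have mD : measurable (D : set plane) := compact_plane_measurable cD.
have area_lty := compact_area_fin cD.
pose free := evades h f.
have free_open t p := @evades_open _ _ _ h_cont f t p cf.
have E_mix : mix_closed E by apply: mix_closed_disk; exact: ltW.
pose F t := slice f t @` unit_itv.
have pathF t : 0 <= t <= 1 -> path_in D (slice f t).
  move=> /unit_itvP It; split; first exact: slice_continuous.
  by move=> s Is; exact: fD.
have F0 t : 0 <= t <= 1 -> measurable (F t : set plane) /\ area (F t) = 0%E.
  move=> t01; have [cs _] := pathF _ t01; split.
    apply: compact_plane_measurable; apply: continuous_compact cs _.
    exact: segment_compact.
  apply: bounded_variation_area0 => //; apply: le_lt_trans (curve_length_variation _) _.
  by apply: frect; exact/unit_itvP.
(* The contaminated part of [D] at time [t]. *)
pose C t := h @` reach E free t.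
have E_reach t : reach E free t `<=` E by move=> p; exact: reach_in.
have oC t : 0 <= t <= 1 -> relatively_open D (C t).
  move=> t01; apply: (homeo_relatively_open hE hK k_cont) => // p rp.
  have fp : free t p by apply: reach_free rp; case/andP: t01.
  have [e e0 He] := reach_local E_mix free_open t01 (E_reach _ _ rp) fp.
  by exists e => // q Eq pq; apply: (He p q) => //; [exact: E_reach rp|exact: ballxx].
(* The cleared part, off the slice. It is relatively open because a reached point close to [p]
   would, by [reach_local], make [p] reached too. *)
pose V t := h @` [set p | [/\ E p, free t p & ~ reach E free t p]].
have oV t : 0 <= t <= 1 -> relatively_open D (V t).
  move=> t01; apply: (homeo_relatively_open hE hK k_cont) => [p []//|p [Ep fp rp]].
  have [e e0 He] := reach_local E_mix free_open t01 Ep fp.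
  have [d d0 Hd] := free_open _ _ t01 Ep fp.
  exists (Num.min e d) => [|q Eq pq]; first by rewrite lt_min e0.
  split => //.
    apply: Hd => //; first by rewrite subrr normr0.
    by apply: le_ball pq; rewrite ge_min lexx orbT.
  apply: contra_not rp; apply: He => //; last exact: ballxx.
  by apply: le_ball pq; rewrite ge_min lexx.
have mC t : 0 <= t <= 1 -> measurable (C t : set plane).
  by move=> t01; apply: relatively_open_measurable mD (oC _ t01).
have mV t : 0 <= t <= 1 -> measurable (V t : set plane).
  by move=> t01; apply: relatively_open_measurable mD (oV _ t01).
have CD t : C t `<=` D.
  by move=> _ [p rp <-]; rewrite -hE; exists p => //; exact: E_reach rp.
have VD t : V t `<=` D by move=> _ [p [Ep _ _] <-]; rewrite -hE; exists p.
have h_inj p q : E p -> E q -> h p = h q -> p = q.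
  by move=> Ep Eq hpq; rewrite -(hK _ Ep) hpq hK.
have CV t : C t `&` V t = set0.
  apply/seteqP; split => // x [[p rp <-] [q [Eq _ rq]] hqp]; apply: rq.
  by rewrite (h_inj q p)//; exact: E_reach rp.
have CVF t : 0 <= t <= 1 -> D `\` F t = C t `|` V t.
  move=> /andP[t0 t1]; apply/seteqP; split => [x []|x [[p rp <-]|[p [Ep fp rp] <-]]].
  - rewrite -hE => -[p Ep <-] fp; have [rp|rp] := pselect (reach E free t p).
      by left; exists p.
    by right; exists p.
  - by split; [apply: (CD t); exists p|exact: (reach_free t0 rp)].
  - by split => //; apply: (VD t); exists p.
(* [C t] and [V t] are disjoint and miss only the null set [F t]. *)
have area_split t : 0 <= t <= 1 -> (area D = area (C t) + area (V t))%E.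
  move=> t01; have [mF aF] := F0 _ t01.
  have CF : C t `|` V t `|` F t = D.
    rewrite -CVF// setUC setDUK// => _ [s Is <-]; exact: (proj2 (pathF _ t01)).
  rewrite -{1}CF /area measureU0//; last by apply: measurableU; [exact: mC|exact: mV].
  by rewrite measureU//; [exact: mC|exact: mV].
have area_ge0 (A : set (R * R)) : (0 <= area A)%E by rewrite /area measure_ge0.
have [a a0 aD] : exists2 a, 0 <= a & area D = a%:E.
  exists (fine (area D)); first exact: fine_ge0.
  by rewrite fineK// ge0_fin_numE.
have [t t01 Ct] : exists2 t, 0 <= t <= 1 & area (C t) = ((2^-1)%:E * area D)%E.
  apply: (@measure_ivt _ _ R (product_measure1 lebesgue_measure lebesgue_measure) C F D) => //.
  (* A point off the slice at time [t] is free at all times near [t], so an evader there shortly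
     before [t] can wait until [t]. *)
  - move=> t x t01; rewrite -{1}hE => -[p Ep <-] fp.
    have [e e0 He] := free_open _ _ t01 Ep fp.
    exists e => // s s0 /andP[ts st] [q rq /esym hpq].
    have pq := h_inj _ _ Ep (E_reach _ _ rq) hpq.
    exists p => //; apply: (reach_stay st); first by rewrite pq.
    case/andP: t01 => t0 t1 u /andP[su ut].
    apply: He => //; [by rewrite (le_trans s0) ?(le_trans ut)| |exact: ballxx].
    by rewrite ger0_norm ?subr_ge0//; lra.
  (* A point reached at time [t] stays free a little longer, so the evader can wait there. *)
  - move=> t x t01 [p rp <-]; have Ep := E_reach _ _ rp.
    case/andP: (t01) => t0 t1.
    have [e e0 He] := free_open _ _ t01 Ep (reach_free t0 rp).
    exists e => // s s1 /andP[ts se]; exists p => //.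
    apply: (reach_stay ts rp) => u /andP[tu us].
    apply: He => //; [by rewrite (le_trans t0) ?(le_trans us)| |exact: ballxx].
    by rewrite distrC ger0_norm ?subr_ge0//; lra.
  (* At time 0 constant paths reach every free point, so nothing is cleared and [C 0] has full
     area. *)
  - have z01 : (0 : R) <= (0 : R) <= 1 by rewrite lexx ler01.
    have V0 : V 0 = set0.
      apply/seteqP; split => // x [p [Ep fp rp] _]; apply: rp; exact: reach0.
    have C0 : area (C 0) = a%:E.
      by rewrite -aD (area_split _ z01) V0 [area set0]measure0 adde0.
    by apply: (@le_trans _ _ (area (C 0))) => //; rewrite C0 aD -EFinM lee_fin; lra.
  (* A point reached at time 1 would yield a path avoiding every slice, which a sweep forbids. *)
  - rewrite (_ : C 1 = set0) ?measure0; first by rewrite mule_ge0// lee_fin invr_ge0.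
    apply/seteqP; split => // x [p [g [cg Eg _ gf]] _].
    have [t /unit_itvP t01 Ft] := fsweep _ (homeo_comp_path hE h_cont cg Eg).
    exact: (gf t t01).
exists t; first exact/unit_itvP.
split; [exact: pathF|by apply: frect; exact/unit_itvP|].
exists (C t), (V t); split => //.
- by split; [exact: oC|exact: oV].
- exact: CVF.
(* The other half follows by subtraction, legitimate because the area of [D] is the real number
   [a]. *)
- have := area_split _ t01; rewrite Ct aD -EFinM => /eqP.
  rewrite addeC -sube_eq ?fin_num_adde_defl// => /eqP <-.
  by rewrite -EFinB; congr (_%:E); lra.
Qed.

End bisection.

Local Open Scope ereal_scope.

Theorem theorem5p4 (R : realType) (D : set (R * R)) :
  jordan_domain D ->
  sweeping_cost D >= ereal_inf [set curve_length g | g in area_bisecting D].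
Proof.
move=> jD; apply: le_ereal_inf_tmp => _ [f fsweep <-].
(* An infinite sensor length makes the bound trivial; a finite one makes every slice rectifiable,
   those at times 0 and 1 included. *)
have [->|fin] := eqVneq (sensor_length f) +oo; first exact: leey.
have slice_le t : unit_itv t -> curve_length (slice f t) <= sensor_length f.
  by move=> It; apply: ereal_sup_ubound; exists t.
have [|t It ft] := sweep_bisecting jD fsweep.
  by move=> t It; apply: le_lt_trans (slice_le _ It) _; rewrite ltey.
by apply: le_trans (slice_le _ It); apply: ereal_inf_lbound; exists (slice f t).
Qed.
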